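(* Let $f:\mathbb{N}\to\mathbb{C}$ be a multiplicative arithmetic function, and let $n$ and $m$ be positive integers with $\gcd(n,m)=1$. Then $$(f*\delta)(nm)=(Id*f)(n)\cdot(f*\delta)(m)+(Id*f)(m)\cdot(f*\delta)(n).$$
   Context: An arithmetic function is a function from the positive integers to $\mathbb{C}$. An arithmetic function $f$ is multiplicative if $f(nm)=f(n)f(m)$ for every pair of coprime positive integers $n,m$. The arithmetic derivative $\delta$ is the function on the positive integers, with values in the nonnegative integers, determined by $\delta(p)=1$ for every prime $p$ and the Leibniz rule $\delta(ab)=\delta(a)b+a\delta(b)$ for all positive integers $a,b$; equivalently, $\delta(n)=n\sum_{i=1}^{s}\frac{\alpha_i}{p_i}$ if $n=\prod_{i=1}^{s}p_i^{\alpha_i}$ is the prime factorization of $n$ (so $\delta(1)=0$). $Id$ is the function $Id(n)=n$. The Dirichlet convolution of arithmetic functions $f,g$ is $(f*g)(n)=\sum_{d\mid n}f(d)\,g(n/d)$, the sum being over all positive divisors $d$ of $n$. *)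

(* Defs.v *)
From mathcomp Require Export all_boot all_order all_algebra.
From mathcomp Require Export reals.
From mathcomp Require Export complex.
Set Implicit Arguments.
Unset Strict Implicit.
Unset Printing Implicit Defensive.
Import GRing.Theory.
Local Open Scope ring_scope.

(* Arithmetic functions are rendered as functions [nat -> C]; the value at 0 is
   junk: no definition below evaluates its arguments at 0 when n is positive. *)

Definition multiplicative_fun (C : comNzRingType) (f : nat -> C) : Prop :=
  forall n m : nat, (0 < n)%N -> (0 < m)%N -> coprime n m ->
    f (n * m)%N = f n * f m.

Definition dirichlet (C : comNzRingType) (f g : nat -> C) (n : nat) : C :=
  \sum_(d <- divisors n) f d * g (n %/ d)%N.

Definition Id_fun (C : comNzRingType) (n : nat) : C := n%:R.

(* n * \sum_(p | n) alpha_p / p, where alpha_p = logn p n; the division by p is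
   exact since p divides n. *)
Definition arith_deriv (n : nat) : nat :=
  (\sum_(p <- primes n) logn p n * (n %/ p))%N.

Definition delta_fun (C : comNzRingType) (n : nat) : C := (arith_deriv n)%:R.

(* [arith_deriv] is the unique function on the positive integers mapping every
   prime to 1 and satisfying the Leibniz rule. *)

Lemma arith_deriv_prime (p : nat) : prime p -> arith_deriv p = 1%N.
Proof.
move=> p_pr; rewrite /arith_deriv primes_prime // big_seq1.
by rewrite logn_prime // eqxx divnn prime_gt0.
Qed.

Lemma arith_deriv_widen (n N : nat) : (0 < n <= N)%N ->
  arith_deriv n =
    (\sum_(p <- index_iota 0 N.+1 | prime p) logn p n * (n %/ p))%N.
Proof.
move=> /andP[n_gt0 le_nN]; rewrite /arith_deriv.
rewrite [RHS](bigID (fun p => p \in primes n)) /= [X in (_ + X)%N]big1 ?addn0.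
  rewrite -[RHS]big_filter; apply: perm_big; apply: uniq_perm.
  - exact: primes_uniq.
  - exact/filter_uniq/iota_uniq.
  move=> p; rewrite mem_filter mem_index_iota ltnS /=.
  case p_n: (p \in primes n); rewrite ?andbF //= andbT.
  move: p_n; rewrite mem_primes => /and3P[-> _ /(dvdn_leq n_gt0) le_pn].
  by rewrite (leq_trans le_pn).
move=> p /andP[p_pr]; rewrite -logn_gt0 lt0n negbK => /eqP ->.
by rewrite mul0n.
Qed.

Lemma arith_derivM (a b : nat) : (0 < a)%N -> (0 < b)%N ->
  arith_deriv (a * b) = (arith_deriv a * b + a * arith_deriv b)%N.
Proof.
move=> a_gt0 b_gt0; have ab_gt0 : (0 < a * b)%N by rewrite muln_gt0 a_gt0.
rewrite !(@arith_deriv_widen _ (a * b)) ?ab_gt0 ?a_gt0 ?b_gt0 ?leqnn //=;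
  rewrite ?leq_pmulr ?leq_pmull //.
rewrite big_distrl big_distrr -big_split /=; apply: eq_bigr => p p_pr.
rewrite lognM // mulnDl; congr (_ + _)%N.
  have [->|] := posnP (logn p a); first by rewrite !mul0n.
  by rewrite logn_gt0 mem_primes => /and3P[_ _ dvd_p]; rewrite -mulnA divn_mulAC.
have [->|] := posnP (logn p b); first by rewrite !mul0n muln0.
rewrite logn_gt0 mem_primes => /and3P[_ _ dvd_p].
by rewrite -muln_divA // mulnCA.
Qed.

Lemma arith_deriv_unique (D : nat -> nat) :
    (forall p : nat, prime p -> D p = 1%N) ->
    (forall a b : nat, (0 < a)%N -> (0 < b)%N ->
      D (a * b)%N = (D a * b + a * D b)%N) ->
  forall n : nat, (0 < n)%N -> D n = arith_deriv n.
Proof.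
move=> Dp DM n; elim/ltn_ind: n => n IHn n_gt0.
have [n_le1 | n_gt1] := leqP n 1.
  have -> : n = 1%N by apply/eqP; rewrite eqn_leq n_le1.
  have /eqP := DM 1%N 1%N isT isT.
  rewrite !muln1 mul1n -[X in X == _]addn0 eqn_add2l eq_sym => /eqP ->.
  by rewrite /arith_deriv big_nil.
have p_pr := pdiv_prime n_gt1; have p_gt0 := prime_gt0 p_pr.
have def_n := divnK (pdiv_dvd n).
have q_gt0 : (0 < n %/ pdiv n)%N by rewrite divn_gt0 // pdiv_leq.
have q_lt : (n %/ pdiv n < n)%N by rewrite ltn_Pdiv // prime_gt1.
suff : D (n %/ pdiv n * pdiv n)%N = arith_deriv (n %/ pdiv n * pdiv n).
  by rewrite def_n.
by rewrite DM // arith_derivM // (Dp _ p_pr) (arith_deriv_prime p_pr) IHn.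
Qed.

(* Main.v *)
Require Import Defs.
From mathcomp Require Import all_boot all_order all_algebra reals complex.
Import GRing.Theory.
Local Open Scope ring_scope.

(** The divisors of [n * m], for coprime [n] and [m], are the products [a * b]
    of a divisor [a] of [n] and a divisor [b] of [m], each arising exactly once
    ([big_divisorsM]). The cofactor of [a * b] is then [(n / a) * (m / b)], so
    multiplicativity of [f] and the Leibniz rule turn each term of the left-hand
    side into
      [f(a) f(b) (delta(n/a) (m/b) + (n/a) delta(m/b))].
    Both summands separate the variables [a] and [b], so the double sum is
      [(f * delta)(n) (f * Id)(m) + (f * Id)(n) (f * delta)(m)],
    and commutativity of the Dirichlet convolution ([dirichletC]) puts it in the
    required form. *)

Lemma perm_divisorsM (n m : nat) :
    (0 < n)%N -> (0 < m)%N -> coprime n m ->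
  perm_eq (divisors (n * m)) [seq (a * b)%N | a <- divisors n, b <- divisors m].
Proof.
move=> n_gt0 m_gt0 co_nm.
apply: uniq_perm => [||d]; first exact: divisors_uniq.
  (* The factors are recovered from the product as its gcds with n and m. *)
  apply: allpairs_uniq; try exact: divisors_uniq.
  have gcd_l a b : (a %| n)%N -> (b %| m)%N -> gcdn n (a * b) = a.
    move=> a_n b_m; rewrite mulnC Gauss_gcdr ?(coprime_dvdr b_m) //.
    exact/gcdn_idPr.
  have gcd_r a b : (a %| n)%N -> (b %| m)%N -> gcdn m (a * b) = b.
    move=> a_n b_m; rewrite Gauss_gcdr ?(coprime_dvdr a_n) 1?coprime_sym //.
    exact/gcdn_idPr.
  move=> _ _ /allpairsP[[a b] [/= + + ->]] /allpairsP[[a' b'] [/= + + ->]].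
  rewrite -!dvdn_divisors // => a_n b_m a'_n b'_m eq_ab.
  by rewrite -(gcd_l a b) // -{2}(gcd_r a b) // eq_ab gcd_l ?gcd_r.
rewrite -dvdn_divisors ?muln_gt0 ?n_gt0 //; apply/idP/allpairsP => [d_nm|].
  exists (gcdn d n, gcdn d m).
  rewrite -!dvdn_divisors //= !dvdn_gcdr; split=> //.
  apply/eqP; rewrite eqn_dvd; apply/andP; split.
    rewrite muln_gcdl !muln_gcdr !dvdn_gcd d_nm.
    by rewrite (dvdn_mull n) // !dvdn_mulr.
  rewrite Gauss_dvd ?dvdn_gcdl //.
  exact: coprime_dvdl (dvdn_gcdr _ _) (coprime_dvdr (dvdn_gcdr _ _) co_nm).
case=> -[a b] [/=]; rewrite -!dvdn_divisors // => a_n b_m ->.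
exact: dvdn_mul.
Qed.

Lemma big_divisorsM (V : nmodType) (F : nat -> V) (n m : nat) :
    (0 < n)%N -> (0 < m)%N -> coprime n m ->
  \sum_(d <- divisors (n * m)) F d =
    \sum_(a <- divisors n) \sum_(b <- divisors m) F (a * b)%N.
Proof.
move=> n_gt0 m_gt0 co_nm.
by rewrite (perm_big _ (perm_divisorsM n m n_gt0 m_gt0 co_nm)) big_allpairs_dep.
Qed.

(** The involution [d |-> n / d] of the divisors of [n] swaps the two factors of
    every term. *)
Lemma dirichletC (C : comNzRingType) (f g : nat -> C) (n : nat) : (0 < n)%N ->
  dirichlet f g n = dirichlet g f n.
Proof.
move=> n_gt0; have divK d : (d %| n)%N -> (n %/ (n %/ d))%N = d.
  by move=> d_n; rewrite divnA // mulKn.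
have perm_div : perm_eq (divisors n) [seq (n %/ d)%N | d <- divisors n].
  apply: uniq_perm => [||d]; first exact: divisors_uniq.
    rewrite map_inj_in_uniq ?divisors_uniq // => a b.
    by rewrite -!dvdn_divisors // => /divK {2}<- /divK {2}<- ->.
  apply/idP/mapP => [|[e]]; rewrite -!dvdn_divisors // => d_n.
    by exists (n %/ d)%N; rewrite ?divK // -dvdn_divisors ?dvdn_div.
  by move=> ->; apply: dvdn_div.
rewrite /dirichlet (perm_big _ perm_div) big_map big_seq [RHS]big_seq.
apply: eq_bigr => d; rewrite -dvdn_divisors // => d_n.
by rewrite divK // mulrC.
Qed.

(** The Leibniz rule for [delta] is an identity between natural numbers, so the
    argument works with coefficients in any commutative ring. *)
Lemma dirichlet_deltaM (C : comNzRingType) (f : nat -> C) (n m : nat) :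
    multiplicative_fun f -> (0 < n)%N -> (0 < m)%N -> coprime n m ->
  dirichlet f (@delta_fun C) (n * m)%N =
    dirichlet (@Id_fun C) f n * dirichlet f (@delta_fun C) m
    + dirichlet (@Id_fun C) f m * dirichlet f (@delta_fun C) n.
Proof.
move=> f_mul n_gt0 m_gt0 co_nm.
rewrite ![dirichlet (@Id_fun C) f _]dirichletC // {1}/dirichlet big_divisorsM //.
rewrite [X in _ = _ + X]mulrC !big_distrl -big_split /=.
rewrite big_seq [RHS]big_seq; apply: eq_bigr => a.
rewrite -dvdn_divisors // => a_n; rewrite !big_distrr -big_split /=.
rewrite big_seq [RHS]big_seq; apply: eq_bigr => b.
rewrite -dvdn_divisors // => b_m.
have [a_gt0 b_gt0] := (dvdn_gt0 n_gt0 a_n, dvdn_gt0 m_gt0 b_m).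
have na_gt0 : (0 < n %/ a)%N := dvdn_gt0 n_gt0 (dvdn_div a_n).
have mb_gt0 : (0 < m %/ b)%N := dvdn_gt0 m_gt0 (dvdn_div b_m).
have co_ab : coprime a b := coprime_dvdl a_n (coprime_dvdr b_m co_nm).
rewrite f_mul //.
have -> : (n * m %/ (a * b) = (n %/ a) * (m %/ b))%N.
  by rewrite divnMA -divn_mulAC // muln_divA.
rewrite /delta_fun /Id_fun arith_derivM //.
rewrite natrD !natrM mulrDr addrC; congr (_ + _); first exact: mulrACA.
exact: mulrACA.
Qed.

Theorem theorem4 (R : realType) (f : nat -> R[i]) (n m : nat)
    (hf : multiplicative_fun f) (hn : (0 < n)%N) (hm : (0 < m)%N)
    (hnm : gcdn n m = 1%N) :
  dirichlet f (@delta_fun R[i]) (n * m)%N =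
    dirichlet (@Id_fun R[i]) f n * dirichlet f (@delta_fun R[i]) m
    + dirichlet (@Id_fun R[i]) f m * dirichlet f (@delta_fun R[i]) n.
Proof. by apply: dirichlet_deltaM => //; apply/eqP. Qed.
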